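(* Suppose that the full system $\dot z=f(z,u)$ with $z=(z_1,z_2,z_c)$ can be decomposed into the form $\dot z_1=f_1(z_1,z_c,u_1)$, $\dot z_2=f_2(z_2,z_c,u_2)$, $\dot z_c=f_c(z_c)$, where the subsystem controls do not have any shared components, so that $u=(u_1,u_2)$. Let $t<0$. If the target sets satisfy $\mathcal T=\mathrm{proj}_1^{-1}(\mathcal T_1)\cup \mathrm{proj}_2^{-1}(\mathcal T_2)$, then the minimal backward reachable sets satisfy $$\mathcal A(t)=\mathrm{proj}_1^{-1}(\mathcal A_1(t))\cup \mathrm{proj}_2^{-1}(\mathcal A_2(t)).$$
   Context: System: $z\in\mathbb R^n$ evolves by $\dot z(s)=f(z(s),u(s))$, $s\in[t,0]$, $t<0$, with $u(s)\in\mathcal U$, $\mathcal U\subset\mathbb R^{n_u}$ compact; $f:\mathbb R^n\times\mathcal U\to\mathbb R^n$ is uniformly continuous, bounded, and Lipschitz continuous in $z$ for fixed $u$. Control functions $u(\cdot)$ range over the set $\mathbb U$ of measurable functions with values in $\mathcal U$. For each $z$ and $u(\cdot)$ let $\zeta(s;z,t,u(\cdot))$, $s\in[t,0]$, be the unique trajectory (satisfying the ODE for almost every $s$) with $\zeta(t;z,t,u(\cdot))=z$. State partition: $z=(z_1,z_2,z_c)$ with $z_i\in\mathbb R^{n_i}$, $z_c\in\mathbb R^{n_c}$, $n_1,n_2>0$, $n_c\ge 0$, $n_1+n_2+n_c=n$. Subsystem states are $x_i=(z_i,z_c)\in\mathbb R^{n_i+n_c}$, $i=1,2$. The control is $u=(u_1,u_2)$,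 where $u_i$ is the control of subsystem $i$. Subsystem $i$ has dynamics $\dot z_i=f_i(z_i,z_c,u_i)$, $\dot z_c=f_c(z_c)$. Its trajectory starting at $x_i$ at time $t$ under $u(\cdot)=(u_1(\cdot),u_2(\cdot))\in\mathbb U$ depends on $u(\cdot)$ only through $u_i(\cdot)$ and is denoted $\xi_i(s;x_i,t,u_i(\cdot))$. Back-projection: for $S_i\subseteq\mathbb R^{n_i+n_c}$, $\mathrm{proj}_i^{-1}(S_i)=\{z=(z_1,z_2,z_c)\in\mathbb R^n:(z_i,z_c)\in S_i\}$. Target sets: $\mathcal T\subseteq\mathbb R^n$ (full system), $\mathcal T_i\subseteq\mathbb R^{n_i+n_c}$ (subsystem $i$). Minimal backward reachable sets: $\mathcal A(t)=\{z:\forall u(\cdot)\in\mathbb U,\ \zeta(0;z,t,u(\cdot))\in\mathcal T\}$ and $\mathcal A_i(t)=\{x_i:\forall u(\cdot)=(u_1(\cdot),u_2(\cdot))\in\mathbb U,\ \xi_i(0;x_i,t,u_i(\cdot))\in\mathcal T_i\}$, $i=1,2$.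
   Formalization: The control set is taken to be a product U1×U2, so u1 and u2 are chosen independently (the claim fails otherwise), and the Lipschitz constant of f in z is taken uniform over u in U (otherwise trajectories need not be unique). *)

(* Defs.v *)
From HB Require Import structures.
From mathcomp Require Export all_boot all_order all_algebra.
From mathcomp Require Export all_classical all_reals all_analysis.

Set Implicit Arguments.
Unset Strict Implicit.
Unset Printing Implicit Defensive.
Import Order.TTheory GRing.Theory Num.Theory.
Import numFieldNormedType.Exports.
Local Open Scope classical_set_scope.
Local Open Scope ring_scope.

Section ControlSystems.
Context {R : realType}.

(* The vector field of a control system only matters on R^N x U; [F] is
   extended arbitrarily to controls outside [U]. *)

Definition unif_continuous_on {N M : nat} (U : set 'rV[R]_M)
    (F : 'rV[R]_N -> 'rV[R]_M -> 'rV[R]_N) : Prop :=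
  forall e : R, 0 < e -> exists2 d : R, 0 < d &
    forall (z z' : 'rV[R]_N) (v v' : 'rV[R]_M), U v -> U v' ->
      `|z - z'| < d -> `|v - v'| < d -> `|F z v - F z' v'| < e.

Definition bounded_on {N M : nat} (U : set 'rV[R]_M)
    (F : 'rV[R]_N -> 'rV[R]_M -> 'rV[R]_N) : Prop :=
  exists K : R, forall (z : 'rV[R]_N) (v : 'rV[R]_M), U v -> `|F z v| <= K.

(* The Lipschitz constant does not depend on the control value: with constants
   depending on [v], trajectories need not be unique
   (F z v = 4 v sin (z / v^2), F z 0 = 0, U = [0, 1], v(s) = s - t, z(t) = 0). *)
Definition lipschitz_state_on {N M : nat} (U : set 'rV[R]_M)
    (F : 'rV[R]_N -> 'rV[R]_M -> 'rV[R]_N) : Prop :=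
  exists k : R, forall v : 'rV[R]_M, U v -> k.-lipschitz (F ^~ v).

(* Measurability into R^M is measurability of each coordinate. Values outside
   [t, 0] are irrelevant. *)
Definition controls {M : nat} (U : set 'rV[R]_M) (t : R) :
    set (R -> 'rV[R]_M) :=
  [set u : R -> 'rV[R]_M |
    (forall j, measurable_fun `[t, 0] (fun s : R => u s ord0 j)) /\
    (forall s, s \in `[t, 0] -> U (u s))].

Definition absolutely_continuous_on {N : nat} (a b : R)
    (g : R -> 'rV[R]_N) : Prop :=
  forall e : R, 0 < e -> exists2 d : R, 0 < d &
    forall (m : nat) (l r : 'I_m -> R),
      (forall i, a <= l i /\ l i <= r i /\ r i <= b) ->
      trivIset setT (fun i => `]l i, r i[%classic) ->
      \sum_(i < m) (r i - l i) < d ->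
      \sum_(i < m) `|g (r i) - g (l i)| < e.

(* Solution in the sense of Caratheodory on [t, 0]. *)
Definition is_trajectory {N M : nat} (F : 'rV[R]_N -> 'rV[R]_M -> 'rV[R]_N)
    (t : R) (z : 'rV[R]_N) (u : R -> 'rV[R]_M) (zeta : R -> 'rV[R]_N) : Prop :=
  [/\ zeta t = z,
      absolutely_continuous_on t 0 zeta &
      {ae lebesgue_measure, forall s : R, s \in `]t, 0[ ->
        is_derive s 1 zeta (F (zeta s) (u s))}].

(* The trajectory s |-> zeta(s; z, t, u): by the Caratheodory theorem it exists
   and is unique on [t, 0] under the assumptions above; values outside [t, 0]
   are meaningless. *)
Definition trajectory {N M : nat} (F : 'rV[R]_N -> 'rV[R]_M -> 'rV[R]_N)
    (t : R) (z : 'rV[R]_N) (u : R -> 'rV[R]_M) : R -> 'rV[R]_N :=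
  xget (fun=> z) [set zeta | is_trajectory F t z u zeta].

Definition min_brs {N M : nat} (U : set 'rV[R]_M)
    (F : 'rV[R]_N -> 'rV[R]_M -> 'rV[R]_N) (T : set 'rV[R]_N) (t : R) :
    set 'rV[R]_N :=
  [set z | forall u, controls U t u -> T (trajectory F t z u 0)].

(* Controls of the full system are quantified over; the subsystem sees their
   component [p]. *)
Definition sub_min_brs {N M M' : nat} (U : set 'rV[R]_M)
    (p : 'rV[R]_M -> 'rV[R]_M') (F : 'rV[R]_N -> 'rV[R]_M' -> 'rV[R]_N)
    (T : set 'rV[R]_N) (t : R) : set 'rV[R]_N :=
  [set x | forall u, controls U t u -> T (trajectory F t x (p \o u) 0)].

Section Partition.
Context {n1 n2 nc : nat}.

Definition part1 (z : 'rV[R]_(n1 + n2 + nc)) : 'rV[R]_n1 := lsubmx (lsubmx z).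
Definition part2 (z : 'rV[R]_(n1 + n2 + nc)) : 'rV[R]_n2 := rsubmx (lsubmx z).
Definition partc (z : 'rV[R]_(n1 + n2 + nc)) : 'rV[R]_nc := rsubmx z.

Definition proj1_inv (S : set 'rV[R]_(n1 + nc)) : set 'rV[R]_(n1 + n2 + nc) :=
  [set z | S (row_mx (part1 z) (partc z))].
Definition proj2_inv (S : set 'rV[R]_(n2 + nc)) : set 'rV[R]_(n1 + n2 + nc) :=
  [set z | S (row_mx (part2 z) (partc z))].

End Partition.

(* Dynamics of x_i = (z_i, z_c). *)
Definition sub_dyn {ni nc M : nat}
    (fi : 'rV[R]_ni -> 'rV[R]_nc -> 'rV[R]_M -> 'rV[R]_ni)
    (fc : 'rV[R]_nc -> 'rV[R]_nc)
    (x : 'rV[R]_(ni + nc)) (v : 'rV[R]_M) : 'rV[R]_(ni + nc) :=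
  row_mx (fi (lsubmx x) (rsubmx x) v) (fc (rsubmx x)).

(* No shared control components: the values of u_1 and u_2 are chosen
   independently, in [U1] and [U2]. *)
Definition control_prod {m1 m2 : nat} (U1 : set 'rV[R]_m1)
    (U2 : set 'rV[R]_m2) : set 'rV[R]_(m1 + m2) :=
  [set v | U1 (lsubmx v) /\ U2 (rsubmx v)].

Definition decomposed {n1 n2 nc m1 m2 : nat} (U : set 'rV[R]_(m1 + m2))
    (f : 'rV[R]_(n1 + n2 + nc) -> 'rV[R]_(m1 + m2) -> 'rV[R]_(n1 + n2 + nc))
    (f1 : 'rV[R]_n1 -> 'rV[R]_nc -> 'rV[R]_m1 -> 'rV[R]_n1)
    (f2 : 'rV[R]_n2 -> 'rV[R]_nc -> 'rV[R]_m2 -> 'rV[R]_n2)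
    (fc : 'rV[R]_nc -> 'rV[R]_nc) : Prop :=
  forall z v, U v ->
    [/\ part1 (f z v) = f1 (part1 z) (partc z) (lsubmx v),
        part2 (f z v) = f2 (part2 z) (partc z) (rsubmx v) &
        partc (f z v) = fc (partc z)].

End ControlSystems.

(* Main.v *)
Require Import Defs.
From mathcomp Require Import lra ring measurable_realfun.
Import Order.TTheory GRing.Theory Num.Theory.
Set Implicit Arguments.
Unset Strict Implicit.
Unset Printing Implicit Defensive.
Import numFieldNormedType.Exports.
Local Open Scope classical_set_scope.
Local Open Scope ring_scope.

(** Projecting a trajectory of the full system on the coordinates of a
    subsystem gives the trajectory of that subsystem under the same control
    ([trajectory_colsub]).  Hence [z] lies in the full set iff every control
    makes one of the two projected endpoints hit its target.  If neither
    subsystem state were in its own set, one control [u] would make subsystem 1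
    miss and another control [u'] would make subsystem 2 miss; the control with
    first part [u_1] and second part [u'_2] is admissible because the parts are
    chosen independently ([controls_row_mx]), and it makes both miss.  The
    other inclusion is immediate.

    The projection step rests on the Caratheodory theorem, since [trajectory]
    is a solution only if one exists and is determined only if solutions are
    unique.

    Both halves use a mean value inequality for absolutely continuous functions
    that are differentiable almost everywhere ([mean_value_ae]).  It is proved
    by covering the exceptional null set by an open set of small measure and
    cutting the interval, by Cousin's lemma, into pieces that either lie in
    this open set, where absolute continuity makes the total increment small,
    or carry a point of differentiability, where the derivative bounds the
    increment.

    In the norm weighted by [exp (- 2 L (s - t))], with [L] a Lipschitz
    constant, the Picard operator then contracts by a factor 1/2
    ([picard_image_contraction]).  This gives uniqueness at once.  For
    existence, the Picard operator is defined on Lipschitz functions by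
    integrating [s |-> F (x s) (u s)], which is measurable because [F] is
    uniformly continuous ([measurable_unif_continuous_comp]) and which is
    almost everywhere the derivative of its integral by the Lebesgue
    differentiation theorem ([bounded_primitive]); its iterates converge
    geometrically to a fixed point ([trajectory_exists]). *)

(** * A mean value inequality for absolutely continuous functions *)

(** Cousin's lemma in the form of an induction principle: the supremum of the
    points [s] for which [P a s] holds cannot be smaller than [b], because [P]
    holds on short intervals around it. *)
Lemma cousin (R : realType) (P : R -> R -> Prop) (a b : R) : a <= b ->
  (forall c d e, a <= c -> c <= d -> d <= e -> e <= b ->
     P c d -> P d e -> P c e) ->
  (forall x, a <= x -> x <= b -> exists2 eta, 0 < eta &
     forall c d, a <= c -> c <= x -> x <= d -> d <= b ->
       x - eta < c -> d < x + eta -> P c d) ->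
  P a b.
Proof.
move=> ab Pcat Ploc.
pose S := [set s | [/\ a <= s, s <= b & P a s]].
have Sa : S a.
  split => //.
  have [eta eta0 Peta] := Ploc _ (lexx a) ab.
  by apply: Peta => //; [rewrite gtrBl|rewrite ltrDl].
have bS : has_sup S by split; [exists a|exists b => s []].
have aS : a <= sup S by apply: ub_le_sup => //; exact: bS.2.
have Sb : sup S <= b by apply: ge_sup; [exists a|move=> s []].
have [eta eta0 Peta] := Ploc _ aS Sb.
have [s [as_ sb Ps] ltss] := sup_adherent eta0 bS.
have sS : s <= sup S by apply: ub_le_sup; [exact: bS.2|].
pose d := Num.min b (sup S + eta / 2).
have supd : sup S <= d.
  by rewrite /d le_min Sb lerDl divr_ge0// ltW.
have Pad : P a d.
  apply: (Pcat _ s) => //; first exact: le_trans supd.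
    by rewrite ge_min lexx.
  apply: Peta => //; first by rewrite ge_min lexx.
  rewrite /d gt_min; apply/orP; right; lra.
have Sd : S d by split=> //; [exact: le_trans supd|rewrite ge_min lexx].
have : d <= sup S by apply: ub_le_sup => //; exact: bS.2.
rewrite ge_min => /orP[bS'|]; last by lra.
suff -> : b = d by [].
by apply/le_anti; rewrite (le_trans bS' supd) /= ge_min lexx.
Qed.

Lemma is_derive_slope (R : realType) (V : normedModType R) (g : R -> V)
    (x : R) (dg : V) (e : R) : is_derive x 1 g dg -> 0 < e ->
  exists2 eta : R, 0 < eta & forall y, `|y - x| < eta ->
    `|g y - g x - (y - x) *: dg| <= e * `|y - x|.
Proof.
move=> [dgx <-] e0.
have /cvgrPdist_le /(_ e e0) [eta /= eta0 Heta] := dgx.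
exists eta => // y yx.
have [->|yNx] := eqVneq y x; first by rewrite !subrr scale0r subr0 !normr0 mulr0.
have yx0 : y - x != 0 by rewrite subr_eq0.
have := Heta (y - x); rewrite /= sub0r normrN => /(_ yx yx0).
rewrite scaler1 subrK => H.
have -> : g y - g x - (y - x) *: 'D_1 g x
   = - ((y - x) *: ('D_1 g x - (y - x)^-1 *: (g y - g x))).
  by rewrite scalerBr scalerA divff// scale1r opprB.
by rewrite normrN normrZ mulrC ler_wpM2r.
Qed.

Lemma negligible_open_cover (R : realType) (N : set R) (e : R) :
  (@lebesgue_measure R).-negligible N -> 0 < e ->
  exists W : set R, [/\ open W, N `<=` W & (lebesgue_measure W < e%:E)%E].
Proof.
move=> [B [mB B0 NB]] e0.
have {}B0 : lebesgue_measure B = 0%E by exact: B0.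
have [|W [oW BO muO]] := @lebesgue_regularity_outer R B e mB _ e0.
  by apply: le_lt_trans (ltry 0); rewrite le_eqVlt (introT eqP B0).
exists W; split=> //; first exact: subset_trans BO.
apply: le_lt_trans muO.
have mW := @open_measurable R W oW.
rewrite -[X in (lebesgue_measure X <= _)%E](@setDUK _ B W)//.
apply: le_trans (@measureU2 _ _ _ _ B (W `\` B) mB _) _ => //.
  exact: measurableD.
by rewrite -[leRHS]add0e; apply: leeD => //; rewrite le_eqVlt (introT eqP B0).
Qed.

Lemma disjoint_itv_sum_le (R : realType) (W : set R) (m : nat)
    (l r : 'I_m -> R) : measurable W ->
  (forall i, l i <= r i) -> (forall i, `]l i, r i[ `<=` W) ->
  trivIset setT (fun i => `]l i, r i[%classic) ->
  ((\sum_(i < m) (r i - l i))%:E <= lebesgue_measure W)%E.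
Proof.
move=> mW lr sO tO.
have -> : ((\sum_(i < m) (r i - l i))%:E =
    \sum_(i < m) lebesgue_measure (`]l i, r i[%classic : set R))%E.
  rewrite -sumEFin; apply: eq_bigr => i _.
  rewrite lebesgue_measure_itv /= lte_fin; case: ltP => // h.
  by congr EFin; have := lr i; lra.
rewrite -measure_bigsetU_ord//=.
apply: le_measure; rewrite ?inE//.
  exact: bigsetU_measurable.
by elim/big_ind: _ => // A B AO BO; rewrite subUset.
Qed.

(** Every point of [[a, b]] has short neighbourhoods on which the increment of
    [g] is either bounded by that of [phi] up to a small multiple
    of the length (at good points), or taken over an interval inside an open
    set [W] of small measure (at bad points).  Cousin's lemma glues these
    estimates; the increments over the intervals in [W] have a small sum by
    absolute continuity. *)
Lemma mean_value_ae (R : realType) (N : nat) (g : R -> 'rV[R]_N)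
    (phi : R -> R) (a b : R) (bad : set R) : a <= b ->
  absolutely_continuous_on a b g ->
  {in `[a, b] &, {homo phi : x y / x <= y}} ->
  (@lebesgue_measure R).-negligible bad ->
  (forall s, a <= s -> s <= b -> ~ bad s -> exists dg dphi,
     [/\ is_derive s 1 g dg, is_derive s 1 phi dphi & `|dg| <= dphi]) ->
  `|g b - g a| <= phi b - phi a.
Proof.
move=> ab acg phiM negbad der.
apply/ler_addgt0Pr => e e0.
have e20 : 0 < e / 2 by rewrite divr_gt0.
have [del del0 acgd] := acg _ e20.
have [W [oW badO muO]] := negligible_open_cover negbad del0.
have mW := @open_measurable R W oW.
(* Half of the error is spent on good pieces, in proportion to their length;
   the 1 avoids a division by 0 when a = b. *)
pose e1 := e / 2 / (b - a + 1).
have ba0 : 0 < b - a + 1 by lra.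
have e10 : 0 < e1 by rewrite divr_gt0.
(* The intervals ]l i, r i[ are the pieces of [c, d] around bad points. *)
pose P c d := exists m (l r : 'I_m -> R),
  [/\ forall i, c <= l i /\ l i <= r i /\ r i <= d,
      forall i, `]l i, r i[ `<=` W,
      trivIset setT (fun i => `]l i, r i[%classic) &
      `|g d - g c| <= phi d - phi c + e1 * (d - c)
                      + \sum_(i < m) `|g (r i) - g (l i)|].
suff [m [l [r [lr lrO tlr gab]]]] : P a b.
  apply: (le_trans gab); rewrite -addrA lerD2l [leRHS](splitr e).
  apply: lerD.
    by rewrite /e1 mulrAC ler_pdivrMr// ler_pM2l//; lra.
  apply/ltW/acgd => //.
  rewrite -lte_fin; apply: le_lt_trans muO; apply: disjoint_itv_sum_le => //.
  by move=> i; have [_ []] := lr i.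
apply: cousin => // [c d k ac cd dk kb|x ax xb].
  move=> [m1 [l1 [r1 [lr1 O1 t1 g1]]]] [m2 [l2 [r2 [lr2 O2 t2 g2]]]].
  exists (m1 + m2)%N.
  pose glue (p : 'I_m1 -> R) (q : 'I_m2 -> R) i :=
    match fintype.split i with inl j => p j | inr j => q j end.
  exists (glue l1 l2), (glue r1 r2); rewrite /glue.
  split.
  - move=> i; case: (fintype.split i) => j.
      by have [? [? ?]] := lr1 j; repeat split => //; exact: le_trans dk.
    by have [? [? ?]] := lr2 j; repeat split => //; exact: le_trans cd _.
  - by move=> i; case: (fintype.split i) => j.
  - move=> i j _ _ [s []].
    rewrite -(fintype.splitK i) -(fintype.splitK j) !unsplitK.
    case: (fintype.split i) => i'; case: (fintype.split j) => j' //=; rewrite !in_itv/=.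
    + by move=> Hi Hj; congr lshift; apply: t1 => //; exists s; rewrite /= !in_itv.
    + move=> /andP[_ si] /andP[js _].
      have [_ [_ h1]] := lr1 i'; have [h2 _] := lr2 j'; exfalso; lra.
    + move=> /andP[is_ _] /andP[_ sj].
      have [_ [_ h1]] := lr1 j'; have [h2 _] := lr2 i'; exfalso; lra.
    + by move=> Hi Hj; congr rshift; apply: t2 => //; exists s; rewrite /= !in_itv.
  - rewrite big_split_ord /=.
    under eq_bigr do rewrite (unsplitK (inl _)).
    under [X in _ + (_ + X)]eq_bigr do rewrite (unsplitK (inr _)).
    have -> : g k - g c = (g k - g d) + (g d - g c) by rewrite addrA subrK.
    apply: le_trans (ler_normD _ _) _.
    by apply: le_trans (lerD g2 g1) _; lra.
have [xbad|xgood] := pselect (bad x).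
  have /= [eta eta0 xO] := (nbhs_ballP _ _).1 (open_nbhs_nbhs (conj oW (badO _ xbad))).
  exists eta => // c d ac cx xd db xc dx.
  exists 1%N, (fun=> c), (fun=> d); split.
  - by move=> _; repeat split => //; exact: le_trans xd.
  - move=> _ s /=; rewrite in_itv /= => /andP[cs sd].
    by apply: xO; rewrite /ball /= ltr_norml; lra.
  - by move=> i j _ _ _; rewrite !ord1.
  - rewrite big_ord1 lerDr addr_ge0//.
      rewrite subr_ge0 phiM// ?in_itv/=; [| |exact: le_trans xd].
        by rewrite ac (le_trans cx).
      by rewrite db (le_trans ac)// (le_trans cx).
    by rewrite mulr_ge0// ?(ltW e10)// subr_ge0 (le_trans cx).
have [dg [dphi [Dg Dphi dgphi]]] := der x ax xb xgood.
have e120 : 0 < e1 / 2 by rewrite divr_gt0.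
have [eta1 eta10 H1] := is_derive_slope Dg e120.
have [eta2 eta20 H2] := is_derive_slope Dphi e120.
exists (Num.min eta1 eta2); first by rewrite lt_min eta10.
move=> c d ac cx xd db xc dx.
have [xc1 xc2 dx1 dx2] : [/\ `|c - x| < eta1, `|c - x| < eta2,
    `|d - x| < eta1 & `|d - x| < eta2].
  move: xc dx; rewrite ltrBlDr -ltrBlDl lt_min => /andP[h1 h2].
  rewrite -ltrBlDl lt_min => /andP[h3 h4].
  by rewrite ler0_norm ?subr_le0// opprB ger0_norm ?subr_ge0.
exists 0%N, (fun=> 0), (fun=> 0); split; try by case.
rewrite big_ord0 addr0.
have gd := H1 _ dx1; have gc := H1 _ xc1.
have pd := H2 _ dx2; have pc := H2 _ xc2.
move: gd gc pd pc.
rewrite [`|c - x|]ler0_norm ?subr_le0// opprB [`|d - x|]ger0_norm ?subr_ge0//.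
move=> gd gc pd pc.
have -> : g d - g c = (g d - g x - (d - x) *: dg) - (g c - g x - (c - x) *: dg)
    + (d - c) *: dg.
  by apply/matrixP => i j; rewrite !mxE; ring.
apply: le_trans (ler_normD _ _) _.
apply: le_trans (lerD (ler_normB _ _) (lexx _)) _.
rewrite normrZ ger0_norm ?subr_ge0 ?(le_trans cx)//.
move: pd pc; rewrite !ler_norml => /andP[pd _] /andP[_ pc].
have : (d - c) * `|dg| <= (d - c) * dphi.
  by rewrite ler_wpM2l// subr_ge0 (le_trans cx).
rewrite /GRing.scale /= in pd pc *.
lra.
Qed.

(** * Contraction of the Picard operator and uniqueness of trajectories *)

Lemma absolutely_continuous_onS (R : realType) (N : nat) (a b c d : R)
    (g : R -> 'rV[R]_N) : a <= c -> d <= b ->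
  absolutely_continuous_on a b g -> absolutely_continuous_on c d g.
Proof.
move=> ac db acg e /acg[del del0 H]; exists del => // m l r lr; apply: H => i.
have [cl [llr rd]] := lr i.
by split; [exact: le_trans cl|split => //; exact: le_trans db].
Qed.

Lemma absolutely_continuous_onB (R : realType) (N : nat) (a b : R)
    (g h : R -> 'rV[R]_N) : absolutely_continuous_on a b g ->
  absolutely_continuous_on a b h ->
  absolutely_continuous_on a b (g \- h).
Proof.
move=> acg ach e e0; have e20 : 0 < e / 2 by rewrite divr_gt0.
have [d1 d10 H1] := acg _ e20; have [d2 d20 H2] := ach _ e20.
exists (Num.min d1 d2); first by rewrite lt_min d10.
move=> m l r lr tlr; rewrite lt_min => /andP[s1 s2].
have := ltrD (H1 _ _ _ lr tlr s1) (H2 _ _ _ lr tlr s2).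
rewrite -splitr; apply: le_lt_trans.
rewrite -big_split; apply: ler_sum => i _ /=.
rewrite [X in `|X|](_ : _ = (g (r i) - g (l i)) - (h (r i) - h (l i))).
  exact: ler_normB.
by rewrite /= !opprD !opprK addrACA.
Qed.

Lemma is_derive_expR_affine (R : realType) (C L t s : R) :
  is_derive s 1 (fun s : R => C * expR (L * (s - t)))
    (C * L * expR (L * (s - t))).
Proof.
have H : is_derive s 1 (fun s : R => expR (L * (s - t)))
    (expR (L * (s - t)) * L).
  have H1 : is_derive s 1 (fun s : R => L * (s - t)) L.
    have -> : (fun s : R => L * (s - t)) = (L *: (@id R - cst t)).
      by apply/funext => x.
    by apply: is_derive_eq; rewrite subr0 /GRing.scale /= mulr1.
  exact: (@is_derive1_comp _ expR (fun s : R => L * (s - t))).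
have -> : (fun s : R => C * expR (L * (s - t)))
   = C *: (fun s : R => expR (L * (s - t))) by apply/funext.
by apply: is_derive_eq; rewrite /GRing.scale /=; ring.
Qed.

(** The bound on the difference of the derivatives is the derivative of
    [C / 2 * expR (2 * L * (s - t))].  The factor 1/2 comes from the choice of
    the exponent as twice the constant [L]. *)
Lemma ae_derive_halving (R : realType) (N : nat) (t L C : R)
    (y y' gam gam' : R -> 'rV[R]_N) : 0 < L -> 0 <= C ->
  absolutely_continuous_on t 0 y -> absolutely_continuous_on t 0 y' ->
  y t = y' t ->
  {ae lebesgue_measure, forall s : R, s \in `]t, 0[ ->
     is_derive s 1 y (gam s)} ->
  {ae lebesgue_measure, forall s : R, s \in `]t, 0[ ->
     is_derive s 1 y' (gam' s)} ->
  (forall s, s \in `]t, 0[ ->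
     `|gam s - gam' s| <= C * L * expR (2 * L * (s - t))) ->
  forall s, s \in `[t, 0] ->
    `|y s - y' s| <= C / 2 * expR (2 * L * (s - t)).
Proof.
move=> L0 C0 acy acy' yt Dy Dy' gamle s; rewrite in_itv /= => /andP[ts s0].
pose phi s := C / 2 * expR (2 * L * (s - t)).
have phiM : {homo phi : a b / a <= b}.
  move=> a b ab; rewrite ler_wpM2l ?divr_ge0// ler_expR ler_wpM2l//.
    by rewrite mulr_ge0// ltW.
  by rewrite lerD2r.
suff : `|(y \- y') s - (y \- y') t| <= phi s - phi t.
  rewrite /= yt subrr subr0 => /le_trans; apply.
  by rewrite gerBl mulr_ge0 ?divr_ge0 ?expR_ge0.
pose A := [set s | s \in `]t, 0[ -> is_derive s 1 y (gam s)].
pose A' := [set s | s \in `]t, 0[ -> is_derive s 1 y' (gam' s)].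
apply: (@mean_value_ae _ _ _ _ _ _ (~` A `|` ~` A' `|` ([set t] `|` [set 0])))
  => //.
- apply: (@absolutely_continuous_onS _ _ t 0) => //.
  exact: absolutely_continuous_onB.
- by move=> a b _ _; exact: phiM.
- apply: negligibleU; first exact: negligibleU.
  by apply: negligibleU; apply/negligibleP => //; exact: lebesgue_measure_set1.
move=> r tr rs bad.
have [rt0 Dyr Dyr'] : [/\ r \in `]t, 0[ , is_derive r 1 y (gam r) &
    is_derive r 1 y' (gam' r)].
  have rI : r \in `]t, 0[.
    rewrite in_itv /= !lt_neqAle tr (le_trans rs s0) !andbT.
    by apply/andP; split; apply/eqP => E; apply: bad; right; [left|right].
  by split => //; apply: contrapT => h; apply: bad; left; [left|right] => /(_ rI).
exists (gam r - gam' r), (C * L * expR (2 * L * (r - t))); split.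
- exact: is_deriveB.
- apply: (is_derive_eq (is_derive_expR_affine _ _ _ _)).
  by rewrite [C / 2 * _]mulrA divfK.
- exact: gamle.
Qed.

Lemma le0_of_le_geometric (R : realType) (D M : R) :
  (forall n, D <= M / 2 ^+ n) -> D <= 0.
Proof.
move=> DM; rewrite leNgt; apply/negP => D0.
have /= := DM (Num.bound `|M / D|).
apply/negP; rewrite -ltNge ltr_pdivrMr ?exprn_gt0// mulrC -ltr_pdivrMr//.
apply: le_lt_trans (ler_norm _) _.
apply: lt_trans (archi_boundP (normr_ge0 _)) _.
by rewrite -natrX ltr_nat ltn_expl.
Qed.


(** [y] is the image of [x] under the Picard operator.  Its fixed points are
    the trajectories: [picard_image F u t z x x] is convertible to
    [is_trajectory F t z u x]. *)
Definition picard_image (R : realType) (N M : nat)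
    (F : 'rV[R]_N -> 'rV[R]_M -> 'rV[R]_N) (u : R -> 'rV[R]_M) (t : R)
    (z : 'rV[R]_N) (x y : R -> 'rV[R]_N) : Prop :=
  [/\ y t = z, absolutely_continuous_on t 0 y &
      {ae lebesgue_measure, forall s : R, s \in `]t, 0[ ->
        is_derive s 1 y (F (x s) (u s))}].

(** Composing with [F] costs a factor [L], which [ae_derive_halving] absorbs:
    in the sup norm weighted by [expR (- 2 * L * (s - t))] the Picard operator
    is a contraction with ratio 1/2. *)
Lemma picard_image_contraction (R : realType) (N M : nat)
    (F : 'rV[R]_N -> 'rV[R]_M -> 'rV[R]_N) (u : R -> 'rV[R]_M) (t L C : R)
    (z : 'rV[R]_N) (x x' y y' : R -> 'rV[R]_N) : 0 < L -> 0 <= C ->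
  (forall s, s \in `[t, 0] -> L.-lipschitz (F ^~ (u s))) ->
  picard_image F u t z x y -> picard_image F u t z x' y' ->
  (forall s, s \in `[t, 0] ->
     `|x s - x' s| <= C * expR (2 * L * (s - t))) ->
  forall s, s \in `[t, 0] ->
    `|y s - y' s| <= C / 2 * expR (2 * L * (s - t)).
Proof.
move=> L0 C0 FL [yt acy Dy] [yt' acy' Dy'] xx'.
have y0 : y t = y' t by rewrite yt.
apply: (ae_derive_halving L0 C0 acy acy' y0 Dy Dy') => r rI.
have rI' : r \in `[t, 0] by exact: subset_itv_oo_cc.
apply: le_trans (FL r rI' (x r, x' r) _) _ => //=.
by rewrite mulrAC [leRHS]mulrC ler_wpM2l ?(ltW L0)// xx'.
Qed.

(** The a priori bound from which the halving starts; it comes from the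
    boundedness of [F] alone, since the derivatives differ by at most [2 K]. *)
Lemma picard_image_bound (R : realType) (N M : nat)
    (F : 'rV[R]_N -> 'rV[R]_M -> 'rV[R]_N) (u : R -> 'rV[R]_M) (t L K : R)
    (z : 'rV[R]_N) (x x' y y' : R -> 'rV[R]_N) : 0 < L -> 0 <= K ->
  (forall s v, s \in `[t, 0] -> `|F v (u s)| <= K) ->
  picard_image F u t z x y -> picard_image F u t z x' y' ->
  forall s, s \in `[t, 0] ->
    `|y s - y' s| <= K / L * expR (2 * L * (s - t)).
Proof.
move=> L0 K0 FK [yt acy Dy] [yt' acy' Dy'].
have y0 : y t = y' t by rewrite yt.
have C0 : 0 <= K / L * 2 by rewrite !mulr_ge0 ?invr_ge0// ltW.
have sub r : r \in `]t, 0[ -> r \in `[t, 0] by exact: subset_itv_oo_cc.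
have := ae_derive_halving L0 C0 acy acy' y0 Dy Dy'.
rewrite mulfK//; apply => r rI.
rewrite [_ * 2 * L]mulrAC divfK ?gt_eqF//; apply: le_trans (ler_normB _ _) _.
apply: le_trans (lerD (FK _ _ (sub _ rI)) (FK _ _ (sub _ rI))) _.
rewrite -mulr2n -[leLHS]mulr_natr ler_peMr ?mulr_ge0// -[leLHS]expR0 ler_expR.
move: rI; rewrite in_itv /= => /andP[/ltW tr _].
by rewrite !mulr_ge0 ?subr_ge0 ?(ltW L0).
Qed.

(** Two trajectories are fixed points of the Picard operator, so their
    distance can be halved indefinitely. *)
Lemma trajectory_unique (R : realType) (N M : nat)
    (F : 'rV[R]_N -> 'rV[R]_M -> 'rV[R]_N) (u : R -> 'rV[R]_M) (t L K : R)
    (z : 'rV[R]_N) (x x' : R -> 'rV[R]_N) : 0 < L -> 0 <= K ->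
  (forall s, s \in `[t, 0] -> L.-lipschitz (F ^~ (u s))) ->
  (forall s v, s \in `[t, 0] -> `|F v (u s)| <= K) ->
  is_trajectory F t z u x -> is_trajectory F t z u x' ->
  forall s, s \in `[t, 0] -> x s = x' s.
Proof.
move=> L0 K0 FL FK tx tx' s sI.
have KL0 : 0 <= K / L by rewrite divr_ge0// ltW.
suff H n : forall s, s \in `[t, 0] ->
    `|x s - x' s| <= K / L / 2 ^+ n * expR (2 * L * (s - t)).
  apply/eqP; rewrite -subr_eq0 -normr_le0.
  apply: (@le0_of_le_geometric _ _ (K / L * expR (2 * L * (s - t)))) => n.
  by rewrite mulrAC H.
elim: n => [|n IHn].
  by rewrite expr0 divr1; exact: (picard_image_bound L0 K0 FK tx tx').
rewrite exprS invfM [X in _ * X]mulrC mulrA.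
by apply: (picard_image_contraction L0 _ FL tx tx' IHn); rewrite divr_ge0.
Qed.

(** * Measurability of the right-hand side and its primitive *)

Lemma rV_norm_leP (R : realType) (N : nat) (v : 'rV[R]_N) (r : R) : 0 <= r ->
  reflect (forall j, `|v 0 j| <= r) (`|v| <= r).
Proof.
move=> r0.
have -> : `|v| = \big[Num.max/0]_ij `|v ij.1 ij.2| := mx_normrE v.
apply: (iffP idP) => [H j|H].
  by apply: le_trans H; exact: (le_bigmax _ (fun ij => `|v ij.1 ij.2|) (0, j)).
by apply: bigmax_le => //= ij _; rewrite (ord1 ij.1).
Qed.

Lemma rV_coord_le (R : realType) (N : nat) (v : 'rV[R]_N) j : `|v 0 j| <= `|v|.
Proof. by apply: (rV_norm_leP v (normr_ge0 v)). Qed.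

(** Around a point of [A] where [h > c], a box with rational centre and radius
    [1 / (k + 1)] can be found whose points in [A] all satisfy [h > c];
    there are countably many such boxes, and their preimages are measurable
    coordinate by coordinate. *)
Lemma measurable_unif_continuous_comp (R : realType) (K : nat) (D : set R)
    (A : set 'rV[R]_K) (h : 'rV[R]_K -> R) (y : R -> 'rV[R]_K) :
  (forall e, 0 < e -> exists2 d, 0 < d &
     forall x x', A x -> A x' -> `|x - x'| < d -> `|h x - h x'| < e) ->
  (forall j, measurable_fun D (fun s => y s 0 j)) ->
  (forall s, D s -> A (y s)) ->
  measurable_fun D (h \o y).
Proof.
move=> hc my Ay mD; apply: (measurability _ (RGenOInfty.measurableE R)) => //.
move=> /= _ [_ [c ->] <-]; rewrite preimage_itvoy.
pose good := [set p : 'rV[rat]_K * nat | forall x, A x ->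
  (forall j, `|x 0 j - ratr (p.1 0 j)| < p.2.+1%:R^-1) -> c < h x].
rewrite [X in measurable X](_ : _ = \bigcup_(p in good)
  (D `&` \bigcap_(j in [set: 'I_K])
    (D `&` [set s | `|y s 0 j - ratr (p.1 0 j)| < p.2.+1%:R^-1]))).
  rewrite bigcup_mkcond; apply: countable_bigcupT_measurable => // p.
  case: ifP => // _; apply: measurableI => //.
  apply: fin_bigcap_measurable => // j _.
  have mf : measurable_fun D (fun s => `|y s 0 j - ratr (p.1 0 j)|).
    apply: measurableT_comp => //; apply: measurable_funB => //.
  rewrite [X in _ `&` X](_ : _ =
      (fun s => `|y s 0 j - ratr (p.1 0 j)|) @^-1` `]-oo, p.2.+1%:R^-1[).
    exact: mf.
  by apply/seteqP; split=> s /=; rewrite in_itv.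
apply/seteqP; split=> s /=.
- move=> [Ds ch].
  have [d d0 hd] := hc (h (y s) - c) ltac:(by rewrite subr_gt0).
  have d20 : 0 < d / 2 by rewrite divr_gt0.
  have [k kd] : exists k : nat, k.+1%:R^-1 < d / 2.
    exists (Num.bound (d / 2)^-1); rewrite invf_plt ?posrE//.
    apply: lt_trans (archi_boundP _) _; first by rewrite invr_ge0 ltW.
    by rewrite ltr_nat.
  pose r : R := k.+1%:R^-1.
  have k0 : 0 < r by rewrite invr_gt0.
  rewrite -/r in kd.
  have H j : exists q : rat, `|y s 0 j - ratr q| < r.
    have [|q] := @rat_in_itvoo _ (y s 0 j - r) (y s 0 j + r).
      lra.
    by rewrite in_itv /= => /andP[h1 h2]; exists q; rewrite ltr_norml; lra.
  have [q qy] := choice H.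
  exists (\row_j q j, k) => /=.
    move=> x Ax xq.
    suff : `|y s - x| < d.
      move=> /(hd _ _ (Ay _ Ds) Ax); rewrite ltr_norml; lra.
    apply: (@le_lt_trans _ _ (r + r)); last lra.
    apply/rV_norm_leP => [|j]; first lra.
    rewrite !mxE; have := qy j; have := xq j; rewrite /= !mxE -/r !ltr_norml.
    by rewrite ler_norml; lra.
  by split => // j _; split => //=; rewrite mxE.
- move=> [p pg [Ds Hj]]; split => //; apply: pg; first exact: Ay.
  by move=> j; have [] := Hj j I.
Qed.

(** The primitive is the integral of [g] extended by 0 outside [[t, 0]], so
    that the Lebesgue differentiation theorem on the whole line applies. *)
Lemma bounded_primitive (R : realType) (t K : R) (g : R -> R) :
  t < 0 -> measurable_fun `[t, 0] g ->
  (forall s, s \in `[t, 0] -> `|g s| <= K) ->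
  exists G : R -> R, [/\ G t = 0,
    forall a b, t <= a -> a <= b -> b <= 0 -> `|G b - G a| <= K * (b - a) &
    {ae lebesgue_measure, forall s, s \in `]t, 0[ -> is_derive s 1 G (g s)}].
Proof.
move=> t0 mg gK.
pose f := g \_ `[t, 0].
have intg : lebesgue_measure.-integrable `[t, 0] (EFin \o g).
  apply: measurable_bounded_integrable => //=.
    by rewrite lebesgue_measure_itv /= lte_fin t0 ltry.
  exists K; split; first exact: num_real.
  by move=> x Kx s /= sI; apply: le_trans (ltW Kx); exact: gK.
have intf : lebesgue_measure.-integrable setT (EFin \o f).
  rewrite /f -restrict_EFin; apply/integrable_restrict => //=.
  by rewrite setTI.
have fK s : `|f s| <= K.
  rewrite /f patchE; case: ifPn => [|_]; first by rewrite inE => /gK.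
  rewrite normr0; apply: le_trans (gK 0 _) => //.
  by rewrite in_itv /= lexx ltW.
have intfI (I : interval R) : lebesgue_measure.-integrable [set` I] (EFin \o f).
  by apply: integrableS intf.
pose G y := \int[lebesgue_measure]_(s in `[t, y]) f s.
exists G; split.
- by rewrite /G set_itv1 Rintegral_set1.
- move=> a b ta ab b0.
  rewrite /G Rintegral_itvB//; rewrite ?bnd_simp//.
  apply: le_trans (le_normr_Rintegral _ _) _ => //.
  apply: (@le_trans _ _ (\int[lebesgue_measure]_(s in `]a, b]) K)).
    have finab : (lebesgue_measure (`]a, b]%classic : set R) < +oo)%E.
      by rewrite lebesgue_measure_itv /=; case: ifP; rewrite ltry.
    apply: le_Rintegral => //; first exact: integrable_norm.
    apply: measurable_bounded_integrable => //.
    exact: bounded_cst.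
  rewrite Rintegral_cst//= lebesgue_measure_itv /= lte_fin.
  case: ltP => //= _.
  by rewrite mulr0 mulr_ge0 ?subr_ge0// (le_trans _ (fK 0)).
- have locf : locally_integrable setT f by exact: integrable_locally_restrict.
  have := lebesgue_differentiation locf.
  apply: filterS; first exact: (ae_filter_ringOfSetsType lebesgue_measure).
  move=> s fs; rewrite in_itv /= => /andP[ts s0].
  have [|dG Gf] := @FTC1_lebesgue_pt R f (BLeft t) s 0 s0 (intfI _) _ fs.
    by rewrite lte_fin.
  split; first exact: dG.
  rewrite -derive1E Gf /f patchE mem_set//=.
  by rewrite in_itv /= !ltW.
Qed.

Definition lipschitz_itv (R : realType) (N : nat) (t K : R)
    (x : R -> 'rV[R]_N) : Prop :=
  forall a b, t <= a -> a <= b -> b <= 0 -> `|x b - x a| <= K * (b - a).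

Lemma lipschitz_itv_ac (R : realType) (N : nat) (t K : R)
    (x : R -> 'rV[R]_N) :
  lipschitz_itv t K x -> absolutely_continuous_on t 0 x.
Proof.
move=> xK e e0.
have K1 : 0 < `|K| + 1 by rewrite ltr_wpDl.
exists (e / (`|K| + 1)); first by rewrite divr_gt0.
move=> m l r lr _; rewrite ltr_pdivlMr// => /(le_lt_trans _); apply.
rewrite mulr_suml; apply: ler_sum => i _.
have [tl [lri r0]] := lr i.
apply: le_trans (xK _ _ tl lri r0) _; rewrite mulrC ler_wpM2l ?subr_ge0//.
by apply: le_trans (ler_norm _) _; rewrite lerDl.
Qed.

Lemma lipschitz_itv_dist (R : realType) (N : nat) (t K : R)
    (x : R -> 'rV[R]_N) a b : lipschitz_itv t K x ->
  a \in `[t, 0] -> b \in `[t, 0] -> `|x a - x b| <= K * `|a - b|.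
Proof.
move=> xK; rewrite !in_itv /= => /andP[ta a0] /andP[tb b0].
have [ab|/ltW ba] := leP a b; last by rewrite [`|a - b|]ger0_norm ?subr_ge0// xK.
by rewrite distrC [`|a - b|]distrC [`|b - a|]ger0_norm ?subr_ge0// xK.
Qed.

Lemma is_derive_mx (R : realType) (N : nat) (y : R -> 'rV[R]_N)
    (s : R) (dy : 'rV[R]_N) :
  (forall j, is_derive s 1 (fun r => y r 0 j) (dy 0 j)) <-> is_derive s 1 y dy.
Proof.
split=> [H|[Dy Ey] j].
  have D : derivable y s 1 by apply/derivable_mxP => i j; rewrite ord1; case: (H j).
  split => //; rewrite derive_mx//; apply/matrixP => i j; rewrite mxE ord1.
  by case: (H j).
split; first by move/derivable_mxP : Dy; exact.
by rewrite -Ey derive_mx// mxE.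
Qed.

Lemma bounded_primitive_rV (R : realType) (N : nat) (t K : R)
    (z : 'rV[R]_N) (gam : R -> 'rV[R]_N) : t < 0 ->
  (forall j, measurable_fun `[t, 0] (fun s => gam s 0 j)) ->
  (forall s, s \in `[t, 0] -> `|gam s| <= K) ->
  exists G, [/\ G t = z, lipschitz_itv t K G &
    {ae lebesgue_measure, forall s, s \in `]t, 0[ -> is_derive s 1 G (gam s)}].
Proof.
move=> t0 mgam gamK.
have H j : exists G : R -> R, [/\ G t = 0,
    forall a b, t <= a -> a <= b -> b <= 0 -> `|G b - G a| <= K * (b - a) &
    {ae lebesgue_measure, forall s, s \in `]t, 0[ ->
       is_derive s 1 G (gam s 0 j)}].
  apply: bounded_primitive => // s sI.
  by apply: le_trans (gamK s sI); exact: rV_coord_le.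
have [G HG] := choice H.
exists (fun s => \row_j (z 0 j + G j s)); split.
- by apply/rowP => j; rewrite mxE; have [-> _ _] := HG j; rewrite addr0.
- move=> a b ta ab b0; apply/rV_norm_leP => [|j].
    rewrite mulr_ge0 ?subr_ge0//; apply: le_trans (gamK 0 _) => //.
    by rewrite in_itv /= lexx ltW.
  by rewrite !mxE opprD addrACA subrr add0r; have [_ /(_ a b) h _] := HG j; exact: h.
- have : {ae lebesgue_measure, forall s, forall j, s \in `]t, 0[ ->
      is_derive s 1 (G j) (gam s 0 j)}.
    have FF := ae_filter_ringOfSetsType (@lebesgue_measure R).
    apply: filter_forall => j.
    by have [] := HG j.
  apply: filterS; first exact: (ae_filter_ringOfSetsType lebesgue_measure).
  move=> s Hs sI; apply/is_derive_mx => j.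
  have -> : (fun r => (\row_j0 (z 0 j0 + G j0 r)) 0 j) = cst (z 0 j) + G j.
    by apply/funext => r; rewrite mxE.
  have ? := Hs j sI.
  by apply: is_derive_eq; rewrite add0r.
Qed.

(** * Existence of trajectories *)

(** The bound on the rate is the sum of the geometric tail. *)
Lemma geometric_cvg (R : realType) (N : nat) (u : nat -> 'rV[R]_N) (M : R) :
  (forall n, `|u n - u n.+1| <= M / 2 ^+ n) ->
  exists l, forall n, `|u n - l| <= M *+ 2 / 2 ^+ n.
Proof.
move=> uM.
have M0 : 0 <= M.
  by have := uM 0%N; rewrite expr0 divr1; apply: le_trans.
(* The exact partial sums are needed for the induction on m. *)
have um n m : `|u n - u (n + m)%N| <= M *+ 2 / 2 ^+ n - M *+ 2 / 2 ^+ (n + m).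
  elim: m => [|m IHm]; first by rewrite addn0 !subrr normr0.
  have -> : u n - u (n + m.+1)%N =
      (u n - u (n + m)%N) + (u (n + m)%N - u (n + m).+1).
    by rewrite addrA subrK addnS.
  apply: le_trans (ler_normD _ _) _; apply: le_trans (lerD IHm (uM _)) _.
  by rewrite addnS exprS invfM; lra.
have le_um n m : `|u n - u (n + m)%N| <= M *+ 2 / 2 ^+ n.
  apply: le_trans (um n m) _; rewrite gerBl.
  by rewrite mulr_ge0 ?mulrn_wge0 ?invr_ge0 ?exprn_ge0.
have cu : cvg (u @ \oo).
  apply: cauchy_cvg; apply: cauchy_exP => e e0.
  have [n ne] : exists n, M *+ 2 / 2 ^+ n < e.
    apply: contrapT => /forallNP h.
    have : e <= 0.
      by apply: (@le0_of_le_geometric _ _ (M *+ 2)) => n; rewrite leNgt; apply/negP/h.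
    by rewrite leNgt e0.
  exists (u n); exists n => // m /= nm.
  by rewrite -ball_normE /= -(subnKC nm); apply: le_lt_trans ne.
exists (lim (u @ \oo)) => n.
apply/ler_addgt0Pr => e e0.
have [k _ Hk] := (cvgrPdist_lt _ _).1 cu _ e0.
have := Hk (n + k)%N (leq_addl _ _); rewrite /= distrC => h.
have -> : u n - lim (u @ \oo) = (u n - u (n + k)%N) + (u (n + k)%N - lim (u @ \oo)).
  by rewrite addrA subrK.
by apply: le_trans (ler_normD _ _) _; apply: lerD => //; exact: ltW.
Qed.

(** Lipschitz functions with constant [K], the bound of [F], are preserved by
    the Picard operator; the Lipschitz property of [x] also yields the
    measurability of [s |-> F (x s) (u s)]. *)
Lemma picard_image_exists (R : realType) (N M : nat) (U : set 'rV[R]_M)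
    (F : 'rV[R]_N -> 'rV[R]_M -> 'rV[R]_N) (u : R -> 'rV[R]_M) (t K : R)
    (z : 'rV[R]_N) (x : R -> 'rV[R]_N) : t < 0 ->
  unif_continuous_on U F -> (forall v w, U w -> `|F v w| <= K) ->
  controls U t u -> lipschitz_itv t K x ->
  exists y, lipschitz_itv t K y /\ picard_image F u t z x y.
Proof.
move=> t0 Fuc FK [mu uU] xK.
have K0 : 0 <= K.
  by apply: le_trans (FK 0 (u 0) _) => //; apply: uU; rewrite in_itv /= lexx ltW.
suff mF j : measurable_fun `[t, 0] (fun s => F (x s) (u s) 0 j).
  have [s sI|y [yt yK Dy]] := bounded_primitive_rV z t0 mF (K := K).
    exact/FK/uU.
  by exists y; split=> //; split=> //; exact: lipschitz_itv_ac yK.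
(* The integrand is a uniformly continuous function of the pair (s, u s),
   encoded as a row vector of size 1 + M. *)
pose A := [set w : 'rV[R]_(1 + M) | lsubmx w 0 0 \in `[t, 0] /\ U (rsubmx w)].
pose h (w : 'rV[R]_(1 + M)) := F (x (lsubmx w 0 0)) (rsubmx w) 0 j.
have -> : (fun s => F (x s) (u s) 0 j) = h \o (fun s => row_mx (const_mx s) (u s)).
  by apply/funext => s; rewrite /h /= row_mxKl row_mxKr mxE.
apply: (@measurable_unif_continuous_comp _ _ _ A).
- move=> e e0; have [d d0 Fd] := Fuc e e0.
  have K1 : 0 < K + 1 by rewrite ltr_wpDl.
  exists (d / (K + 1)); first by rewrite divr_gt0.
  move=> w w' [wI wU] [wI' wU'] ww'.
  rewrite /h -[X in `|X|](_ : (F (x (lsubmx w 0 0)) (rsubmx w) -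
     F (x (lsubmx w' 0 0)) (rsubmx w')) 0 j = _); last by rewrite !mxE.
  apply: le_lt_trans (rV_coord_le _ _) _; apply: Fd => //.
    apply: le_lt_trans (lipschitz_itv_dist xK wI wI') _.
    move: ww'; rewrite ltr_pdivlMr// => /(le_lt_trans _); apply.
    rewrite mulrC; apply: ler_pM => //; last by rewrite lerDl.
    by have := rV_coord_le (w - w') (lshift M 0); rewrite !mxE.
  apply: (@le_lt_trans _ _ `|w - w'|).
    apply/rV_norm_leP => // i.
    by have := rV_coord_le (w - w') (rshift 1 i); rewrite !mxE.
  by apply: lt_le_trans ww' _; rewrite ler_pdivrMr// ler_peMr ?(ltW d0)// lerDr.
- move=> i; have [i'|i'] := split_ordP i.
  + move=> ->; rewrite [X in measurable_fun _ X](_ : _ = id).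
      exact: measurable_id.
    by apply/funext => s; rewrite /= row_mxEl mxE.
  + move=> ->; rewrite [X in measurable_fun _ X](_ : _ = fun s => u s 0 i').
      exact: mu.
    by apply/funext => s; rewrite /= row_mxEr.
- by move=> s sI; rewrite /A /= row_mxKl row_mxKr mxE; split => //; exact: uU.
Qed.

(** The iterates from a constant function converge geometrically at each time.
    Their limit [x] is again Lipschitz, so it has a Picard image [y], and the
    contraction shows that [y] is also the limit of the iterates.  Then [x] and
    [y] agree on [[t, 0]] and [y] is a trajectory. *)
Lemma trajectory_exists (R : realType) (N M : nat) (U : set 'rV[R]_M)
    (F : 'rV[R]_N -> 'rV[R]_M -> 'rV[R]_N) (u : R -> 'rV[R]_M) (t K L : R)
    (z : 'rV[R]_N) : t < 0 -> 0 < L ->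
  unif_continuous_on U F -> (forall v w, U w -> `|F v w| <= K) ->
  (forall w, U w -> L.-lipschitz (F ^~ w)) ->
  controls U t u -> exists x, is_trajectory F t z u x.
Proof.
move=> t0 L0 Fuc FK FL cu.
have uU : forall s, s \in `[t, 0] -> U (u s) by case: cu.
have K0 : 0 <= K.
  by apply: le_trans (FK 0 (u 0) _) => //; apply: uU; rewrite in_itv /= lexx ltW.
have KL0 : 0 <= K / L by rewrite divr_ge0// ltW.
have FKu s v : s \in `[t, 0] -> `|F v (u s)| <= K by move=> /uU; exact: FK.
have FLu s : s \in `[t, 0] -> L.-lipschitz (F ^~ (u s)) by move=> /uU; exact: FL.
(* Phi x is an arbitrary function when x is not Lipschitz. *)
have /choice[Phi HPhi] : forall x, exists y, lipschitz_itv t K x ->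
    lipschitz_itv t K y /\ picard_image F u t z x y.
  move=> x; have [xK|xK] := pselect (lipschitz_itv t K x); last by exists x.
  by have [y Hy] := picard_image_exists z t0 Fuc FK cu xK; exists y.
pose X n := iter n Phi (cst z).
have XK n : lipschitz_itv t K (X n).
  elim: n => [a b _ ab _|n /HPhi[]//].
  by rewrite subrr normr0 mulr_ge0// subr_ge0.
have XP n : picard_image F u t z (X n) (X n.+1) by have [] := HPhi _ (XK n).
have Xn n s : s \in `[t, 0] ->
    `|X n.+1 s - X n.+2 s| <= K / L / 2 ^+ n * expR (2 * L * (s - t)).
  elim: n s => [|n IHn].
    by rewrite expr0 divr1; exact: (picard_image_bound L0 K0 FKu (XP _) (XP _)).
  rewrite exprS invfM [X in _ * X]mulrC mulrA.
  apply: (picard_image_contraction L0 _ FLu (XP _) (XP _) IHn).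
  by rewrite mulr_ge0 ?invr_ge0.
have /choice[x Hx] : forall s, exists l, s \in `[t, 0] -> forall n,
    `|X n.+1 s - l| <= (K / L * expR (2 * L * (s - t))) *+ 2 / 2 ^+ n.
  move=> s; have [sI|sI] := pselect (s \in `[t, 0]); last by exists 0.
  have [n|l Hl] := @geometric_cvg _ _ (fun n => X n.+1 s)
      (K / L * expR (2 * L * (s - t))).
    by rewrite mulrAC; exact: Xn.
  by exists l.
have xK : lipschitz_itv t K x.
  move=> a b ta ab b0; rewrite -subr_le0.
  have aI : a \in `[t, 0] by rewrite in_itv /= ta (le_trans ab).
  have bI : b \in `[t, 0] by rewrite in_itv /= b0 (le_trans ta).
  apply: (@le0_of_le_geometric _ _ ((K / L * expR (2 * L * (a - t))) *+ 2 +
     (K / L * expR (2 * L * (b - t))) *+ 2)) => n.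
  rewrite lerBlDr mulrDl.
  have -> : x b - x a = (X n.+1 a - x a) - (X n.+1 b - x b)
      + (X n.+1 b - X n.+1 a).
    by apply/matrixP => i j; rewrite !mxE; ring.
  apply: le_trans (ler_normD _ _) _; apply: lerD; last exact: XK.
  by apply: le_trans (ler_normB _ _) _; apply: lerD; exact: Hx.
have [y [yK xy]] := picard_image_exists z t0 Fuc FK cu xK.
have xyE s : s \in `[t, 0] -> x s = y s.
  move=> sI; apply/eqP; rewrite -subr_eq0 -normr_le0.
  apply: (@le0_of_le_geometric _ _ ((K / L * expR (2 * L * (s - t))) *+ 2)) => n.
  have Hxn r : r \in `[t, 0] -> `|X n.+1 r - x r| <=
      (K / L) *+ 2 / 2 ^+ n * expR (2 * L * (r - t)).
    by move=> rI; have := Hx r rI n; rewrite -mulrnAl mulrAC.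
  have KLn0 : 0 <= (K / L) *+ 2 / 2 ^+ n.
    by rewrite mulr_ge0 ?mulrn_wge0 ?invr_ge0 ?exprn_ge0.
  have h := picard_image_contraction L0 KLn0 FLu (XP n.+1) xy Hxn sI.
  have h' := Hx s sI n.+1.
  have -> : x s - y s = (X n.+2 s - y s) - (X n.+2 s - x s).
    by apply/matrixP => i j; rewrite !mxE; ring.
  apply: le_trans (ler_normB _ _) _; apply: le_trans (lerD h h') _.
  by rewrite exprS invfM; lra.
exists y; case: xy => yt acy Dy; split => //.
move: Dy; apply: filterS.
  exact: (ae_filter_ringOfSetsType lebesgue_measure).
by move=> s Hs sI; rewrite -xyE; [exact: Hs|exact: subset_itv_oo_cc].
Qed.

(** * Trajectories of the subsystems *)

Lemma norm_colsub (R : realType) (N N' : nat) (sigma : 'I_N' -> 'I_N)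
    (z : 'rV[R]_N) : `|colsub sigma z| <= `|z|.
Proof. by apply/rV_norm_leP => // j; rewrite mxE; exact: rV_coord_le. Qed.

(** For injective [sigma], a right inverse of [colsub sigma] that does not
    increase distances.  It transports the bounds on the full vector field to
    those of a subsystem. *)
Definition extend0 (R : realType) (N N' : nat) (sigma : 'I_N' -> 'I_N)
    (x : 'rV[R]_N') : 'rV[R]_N :=
  \row_i if [pick j | sigma j == i] is Some j then x 0 j else 0.

Lemma extend0K (R : realType) (N N' : nat) (sigma : 'I_N' -> 'I_N)
    (x : 'rV[R]_N') :
  injective sigma -> colsub sigma (extend0 sigma x) = x.
Proof.
move=> sigma_inj.
apply/rowP => j; rewrite !mxE.
by case: pickP => [k /eqP/sigma_inj ->//|/(_ j)]; rewrite eqxx.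
Qed.

Lemma norm_extend0B (R : realType) (N N' : nat) (sigma : 'I_N' -> 'I_N)
    (x x' : 'rV[R]_N') :
  `|extend0 sigma x - extend0 sigma x'| <= `|x - x'|.
Proof.
apply/rV_norm_leP => // i; rewrite !mxE; case: pickP => [j _|_].
  by have := rV_coord_le (x - x') j; rewrite !mxE.
by rewrite subrr normr0.
Qed.

(** A full trajectory exists; its projection is a trajectory of the subsystem,
    which inherits boundedness and the Lipschitz property from the full system
    along the control and therefore has no other trajectory. *)
Lemma trajectory_colsub (R : realType) (N N' M M' : nat)
    (sigma : 'I_N' -> 'I_N) (U : set 'rV[R]_M)
    (F : 'rV[R]_N -> 'rV[R]_M -> 'rV[R]_N)
    (F' : 'rV[R]_N' -> 'rV[R]_M' -> 'rV[R]_N') (p : 'rV[R]_M -> 'rV[R]_M')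
    (t : R) (z : 'rV[R]_N) (u : R -> 'rV[R]_M) : injective sigma -> t < 0 ->
  unif_continuous_on U F -> bounded_on U F -> lipschitz_state_on U F ->
  (forall z v, U v -> F' (colsub sigma z) (p v) = colsub sigma (F z v)) ->
  controls U t u ->
  trajectory F' t (colsub sigma z) (p \o u) 0 =
    colsub sigma (trajectory F t z u 0).
Proof.
move=> sigma_inj t0 Fuc [K0 FK0] [L0 FL0] FF' cu.
have uU : forall s, s \in `[t, 0] -> U (u s) by case: cu.
pose K := Num.max K0 0; pose L := Num.max L0 1.
have K_ge0 : 0 <= K by rewrite le_max lexx orbT.
have L_gt0 : 0 < L by rewrite lt_max ltr01 orbT.
have FK v w : U w -> `|F v w| <= K.
  by move=> Uw; apply: le_trans (FK0 v w Uw) _; rewrite le_max lexx.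
have FL w : U w -> L.-lipschitz (F ^~ w).
  move=> Uw [a b] _; apply: le_trans (FL0 w Uw (a, b) _) _ => //.
  by rewrite ler_wpM2r// le_max lexx.
have [yt acy Dy] : is_trajectory F t z u (trajectory F t z u).
  by apply: xgetPex; exact: trajectory_exists t0 L_gt0 Fuc FK FL cu.
set y := trajectory F t z u in yt acy Dy *.
have Fxv x s : s \in `[t, 0] ->
    F' x (p (u s)) = colsub sigma (F (extend0 sigma x) (u s)).
  by move=> /uU Us; rewrite -FF'// extend0K.
have py : is_trajectory F' t (colsub sigma z) (p \o u) (colsub sigma \o y).
  split; first by rewrite /= yt.
    move=> e /acy[d d0 H]; exists d => // m l r lr tlr lrd.
    apply: le_lt_trans (H m l r lr tlr lrd); apply: ler_sum => i _.
    by rewrite /= -linearB norm_colsub.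
  move: Dy; apply: filterS.
    exact: (ae_filter_ringOfSetsType lebesgue_measure).
  move=> s Hs sI; rewrite /= FF'; last by apply/uU/subset_itv_oo_cc.
  apply/is_derive_mx => j; rewrite mxE /=.
  have -> : (fun r => colsub sigma (y r) 0 j) = (fun r => y r 0 (sigma j)).
    by apply/funext => r; rewrite mxE.
  by have /is_derive_mx := Hs sI; exact.
have ty : is_trajectory F' t (colsub sigma z) (p \o u)
    (trajectory F' t (colsub sigma z) (p \o u)).
  by apply: xgetPex; exists (colsub sigma \o y).
apply: (trajectory_unique L_gt0 K_ge0 _ _ ty py); last first.
- by rewrite in_itv /= lexx ltW.
- by move=> s v sI; rewrite /= Fxv//; apply: le_trans (norm_colsub _ _) _; exact/FK/uU.
- move=> s sI [a b] _ /=; rewrite !Fxv// -linearB.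
  apply: le_trans (norm_colsub _ _) _.
  apply: le_trans (FL _ (uU _ sI) (extend0 sigma a, extend0 sigma b) _) _ => //=.
  by rewrite ler_wpM2l ?norm_extend0B// ltW.
Qed.

Section Subsystems.
Context {R : realType} {n1 n2 nc : nat}.

Definition sub1_coord (j : 'I_(n1 + nc)) : 'I_(n1 + n2 + nc) :=
  match fintype.split j with
  | inl i => lshift nc (lshift n2 i)
  | inr k => rshift (n1 + n2) k
  end.

Definition sub2_coord (j : 'I_(n2 + nc)) : 'I_(n1 + n2 + nc) :=
  match fintype.split j with
  | inl i => lshift nc (rshift n1 i)
  | inr k => rshift (n1 + n2) k
  end.

Lemma sub1_coord_inj : injective sub1_coord.
Proof.
move=> i j; rewrite /sub1_coord.
case: split_ordP => i' ->; case: split_ordP => j' ->.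
- by move=> /lshift_inj/lshift_inj ->.
- by move=> /eqP; rewrite eq_lrshift.
- by move=> /eqP; rewrite eq_rlshift.
- by move=> /rshift_inj ->.
Qed.

Lemma sub2_coord_inj : injective sub2_coord.
Proof.
move=> i j; rewrite /sub2_coord.
case: split_ordP => i' ->; case: split_ordP => j' ->.
- by move=> /lshift_inj/rshift_inj ->.
- by move=> /eqP; rewrite eq_lrshift.
- by move=> /eqP; rewrite eq_rlshift.
- by move=> /rshift_inj ->.
Qed.

Lemma sub1_stateE (z : 'rV[R]_(n1 + n2 + nc)) :
  row_mx (part1 z) (partc z) = colsub sub1_coord z.
Proof.
by apply/rowP => j; rewrite !mxE /sub1_coord; case: fintype.split => i; rewrite !mxE.
Qed.

Lemma sub2_stateE (z : 'rV[R]_(n1 + n2 + nc)) :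
  row_mx (part2 z) (partc z) = colsub sub2_coord z.
Proof.
by apply/rowP => j; rewrite !mxE /sub2_coord; case: fintype.split => i; rewrite !mxE.
Qed.

End Subsystems.

(** * Minimal backward reachable sets *)

(** This is where the absence of shared control components enters: the two
    parts of a control may come from different controls. *)
Lemma controls_row_mx (R : realType) (m1 m2 : nat) (U1 : set 'rV[R]_m1)
    (U2 : set 'rV[R]_m2) (t : R) (u u' : R -> 'rV[R]_(m1 + m2)) :
  controls (control_prod U1 U2) t u -> controls (control_prod U1 U2) t u' ->
  controls (control_prod U1 U2) t
    (fun s => row_mx (lsubmx (u s)) (rsubmx (u' s))).
Proof.
move=> [mu uU] [mu' uU']; split.
  move=> j; have [i ->|i ->] := split_ordP j.
    rewrite [X in measurable_fun _ X](_ : _ = fun s => u s 0 (lshift m2 i))//.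
    by apply/funext => s; rewrite row_mxEl mxE.
  rewrite [X in measurable_fun _ X](_ : _ = fun s => u' s 0 (rshift m1 i))//.
  by apply/funext => s; rewrite row_mxEr mxE.
move=> s sI; rewrite /control_prod /= row_mxKl row_mxKr.
by split; [case: (uU s sI)|case: (uU' s sI)].
Qed.

Theorem proposition2 (R : realType) (n1 n2 nc m1 m2 : nat)
  (U1 : set 'rV[R]_m1) (U2 : set 'rV[R]_m2) (U : set 'rV[R]_(m1 + m2))
  (f : 'rV[R]_(n1 + n2 + nc) -> 'rV[R]_(m1 + m2) -> 'rV[R]_(n1 + n2 + nc))
  (f1 : 'rV[R]_n1 -> 'rV[R]_nc -> 'rV[R]_m1 -> 'rV[R]_n1)
  (f2 : 'rV[R]_n2 -> 'rV[R]_nc -> 'rV[R]_m2 -> 'rV[R]_n2)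
  (fc : 'rV[R]_nc -> 'rV[R]_nc)
  (T : set 'rV[R]_(n1 + n2 + nc))
  (T1 : set 'rV[R]_(n1 + nc)) (T2 : set 'rV[R]_(n2 + nc)) (t : R) :
  (0 < n1)%N -> (0 < n2)%N ->
  compact U ->
  unif_continuous_on U f -> bounded_on U f -> lipschitz_state_on U f ->
  U = control_prod U1 U2 ->
  decomposed U f f1 f2 fc ->
  t < 0 ->
  T = proj1_inv T1 `|` proj2_inv T2 ->
  min_brs U f T t =
    proj1_inv (sub_min_brs U lsubmx (sub_dyn f1 fc) T1 t) `|`
    proj2_inv (sub_min_brs U rsubmx (sub_dyn f2 fc) T2 t).
Proof.
move=> _ _ _ fuc fK fL UE dec t0 ->.
have traj1 z u : controls U t u ->
    trajectory (sub_dyn f1 fc) t (row_mx (part1 z) (partc z)) (lsubmx \o u) 0 =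
    row_mx (part1 (trajectory f t z u 0)) (partc (trajectory f t z u 0)).
  rewrite !sub1_stateE; apply: trajectory_colsub => //.
    exact: sub1_coord_inj.
  move=> z' v Uv; have [e1 _ ec] := dec z' v Uv.
  by rewrite -!sub1_stateE /sub_dyn row_mxKl row_mxKr e1 ec.
have traj2 z u : controls U t u ->
    trajectory (sub_dyn f2 fc) t (row_mx (part2 z) (partc z)) (rsubmx \o u) 0 =
    row_mx (part2 (trajectory f t z u 0)) (partc (trajectory f t z u 0)).
  rewrite !sub2_stateE; apply: trajectory_colsub => //.
    exact: sub2_coord_inj.
  move=> z' v Uv; have [_ e2 ec] := dec z' v Uv.
  by rewrite -!sub2_stateE /sub_dyn row_mxKl row_mxKr e2 ec.
apply/seteqP; split=> z.
- move=> Az; apply: contrapT => /not_orP[].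
  move=> /existsNP[u /not_implyP[cu T1u]] /existsNP[u' /not_implyP[cu' T2u']].
  pose w s := row_mx (lsubmx (u s)) (rsubmx (u' s)).
  have cw : controls U t w by rewrite UE in cu cu' *; exact: controls_row_mx.
  have [] := Az w cw; rewrite /proj1_inv /proj2_inv /=.
    rewrite -traj1// (_ : lsubmx \o w = lsubmx \o u)//.
    by apply/funext => s; rewrite /= row_mxKl.
  rewrite -traj2// (_ : rsubmx \o w = rsubmx \o u')//.
  by apply/funext => s; rewrite /= row_mxKr.
- move=> [Az|Az] u cu; [left|right]; rewrite /proj1_inv /proj2_inv /=.
    by rewrite -traj1//; exact: Az.
  by rewrite -traj2//; exact: Az.
Qed.
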